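(* Let $q$ be a prime power, $\ell\geq 2$, and let $\mathcal{A}$ be a central hyperplane arrangement in $\mathbb{F}_q^\ell$. If $\chi(\mathcal{A},q^{\ell-2})=0$, then $\mathcal{A}$ is free with exponents $(1,q,q^2,\dots,q^{\ell-2},\ |\mathcal{A}|-1-q-q^2-\cdots-q^{\ell-2})$.
   Context: A (central) hyperplane arrangement $\mathcal{A}$ in $V=\mathbb{K}^\ell$ is a finite set of codimension-one linear subspaces. Characteristic polynomial: $\chi(\mathcal{A},t)=\sum_{X\in L(\mathcal{A})}\mu(X)t^{\dim X}$, where $L(\mathcal{A})$ is the set of intersections of subsets of $\mathcal{A}$ (including $V$) ordered by reverse inclusion with minimum $\hat0=V$, and $\mu(\hat0)=1$, $\mu(X)=-\sum_{Y<X}\mu(Y)$ for $X>\hat0$. Let $S=\mathbb{K}[x_1,\dots,x_\ell]$, fix for each $H\in\mathcal{A}$ a nonzero linear form $\alpha_H$ with kernel $H$; $D(\mathcal{A})=\{\delta\in \mathrm{Der}_V : \delta(\alpha_H)\in\alpha_H S\ \forall H\in\mathcal{A}\}$, where $\mathrm{Der}_V=\bigoplus_i S\,\partial/\partial x_i$. $\mathcal{A}$ is free if $D(\mathcal{A})$ is a free $S$-module; the exponents are the multiset of degrees of a homogeneous basis. *)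

(* Defs.v *)
From mathcomp Require Import all_boot all_order all_algebra all_field.
From mathcomp Require Import mpoly.

Set Implicit Arguments.
Unset Strict Implicit.
Unset Printing Implicit Defensive.

Import GRing.Theory.
Local Open Scope ring_scope.

(* Hyperplane arrangements in V = F^l, F a finite field.
   Vectors of V are row vectors 'rV[F]_l; a linear subspace is represented by
   its (finite) set of vectors. *)
Section Arrangements.
Variables (F : finFieldType) (l : nat).

Local Notation vec := 'rV[F]_l.

Definition is_hyperplane (H : {set vec}) : Prop :=
  exists U : {vspace vec}, (\dim U).+1 = l /\ H = [set v | v \in U].

Definition is_arrangement (A : {set {set vec}}) : Prop :=
  forall H, H \in A -> is_hyperplane H.

Definition intersection_lattice (A : {set {set vec}}) : {set {set vec}} :=
  [set (\bigcap_(H in B) H) | B : {set {set vec}} in powerset A].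

(* Moebius function, defined by the recursion mu(V) = 1,
   mu(X) = - sum_{Y < X} mu(Y), where Y < X in reverse inclusion means
   X \proper Y.  The recursion is run with fuel (enough since every strict
   chain in L(A) has length at most #|vec|). *)
Fixpoint mobius_rec (L : {set {set vec}}) (n : nat) (X : {set vec}) : int :=
  match n with
  | 0 => 0
  | n'.+1 =>
      if X == setT then 1
      else - \sum_(Y in L | X \proper Y) mobius_rec L n' Y
  end.

Definition mobius (A : {set {set vec}}) (X : {set vec}) : int :=
  mobius_rec (intersection_lattice A) #|vec|.+1 X.

Definition sdim (X : {set vec}) : nat := \dim <<enum X>>%VS.

Definition arr_char_poly (A : {set {set vec}}) : {poly int} :=
  \sum_(X in intersection_lattice A) mobius A X *: 'X^(sdim X).

Definition linform (a : vec) : {mpoly F[l]} := \sum_(i < l) a 0 i *: 'X_i.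

(* Der_V = S^l: delta = sum_i theta_i d/dx_i, stored as a row vector. *)
Definition der_apply (theta : 'rV[{mpoly F[l]}]_l) (p : {mpoly F[l]}) :
  {mpoly F[l]} := \sum_(i < l) theta 0 i * mderiv i p.

Definition in_DA (A : {set {set vec}}) (alpha : {set vec} -> vec)
  (theta : 'rV[{mpoly F[l]}]_l) : Prop :=
  forall H, H \in A ->
    exists g : {mpoly F[l]},
      der_apply theta (linform (alpha H)) = linform (alpha H) * g.

Definition free_with_exponents (A : {set {set vec}}) (alpha : {set vec} -> vec)
  (ds : seq nat) : Prop :=
  exists (B : 'I_l -> 'rV[{mpoly F[l]}]_l) (d : 'I_l -> nat),
    [/\ forall j, in_DA A alpha (B j),
        forall j i, (B j) 0 i \is (d j).-homog,
        forall c : 'I_l -> {mpoly F[l]},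
          \sum_(j < l) c j *: B j = 0 -> forall j, c j = 0,
        forall theta, in_DA A alpha theta ->
          exists c : 'I_l -> {mpoly F[l]}, theta = \sum_(j < l) c j *: B j
      & perm_eq [seq d j | j <- enum 'I_l] ds].

End Arrangements.

(* Main.v *)
Require Import Defs.
From HB Require Import structures.
From mathcomp Require Import all_boot all_order all_algebra all_field.
From mathcomp Require Import mpoly.

(* By Moebius inversion, [chi(q^k)] counts the k-tuples of vectors that lie in
   no common hyperplane of the arrangement.  For [k = l - 2] its vanishing says
   that every rational subspace of codimension 2 lies in a hyperplane of [A],
   i.e. that the defining polynomial [Q] of [A] vanishes on all of them.

   Let [theta_r = sum_c x_c^(q^r) d/dx_c] for [r < l - 1]; these are tangent to
   all rational hyperplanes.  The maximal minors of their coefficient matrix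
   are Moore determinants, i.e. up to sign the products [omit_prod j] of all
   forms, normalized up to scalars, in which [x_j] does not occur.  These
   minors generate the ideal of polynomials vanishing on all rational subspaces
   of codimension 2: such a polynomial can be divided, modulo the minors, by
   all normalized forms one after the other, in the order given by their
   leading variable, and the product of all of them is in the ideal.

   Hence [Q] is the determinant of the matrix with rows [theta_r] and one more
   row [theta], which can be taken homogeneous.  As the [theta_r] are
   independent along each hyperplane of [A], [theta] is tangent to it, and
   Cramer's rule shows that the rows form a basis of [D(A)]. *)

Set Implicit Arguments.
Unset Strict Implicit.
Unset Printing Implicit Defensive.

Import GRing.Theory Num.Theory.
Local Open Scope ring_scope.

(** * Counting tuples with the characteristic polynomial *)

Section CharPoly.
Variables (F : finFieldType) (l : nat) (A : {set {set 'rV[F]_l}}).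

Local Notation vec := 'rV[F]_l.
Local Notation L := (intersection_lattice A).

Lemma mobius_rec_fuel (n n' : nat) (X : {set vec}) :
  (#|~: X| < n)%N -> (#|~: X| < n')%N ->
  mobius_rec L n X = mobius_rec L n' X.
Proof.
elim: n n' X => [|n IHn] [|n'] X //=; rewrite !ltnS => ltn ltn'.
case: eqP => // _; congr (- _); apply: eq_bigr => Y /andP[_ ltXY].
have ltC: (#|~: Y| < #|~: X|)%N by apply: proper_card; rewrite properC.
by apply: IHn; apply: leq_trans ltC _.
Qed.

Lemma mobius_sum (Y : {set vec}) : Y \in L ->
  \sum_(X in L | Y \subset X) mobius A X = (Y == setT)%:R.
Proof.
move=> LY; rewrite (bigD1 Y) /=; last by rewrite LY subxx.
have cardC (X : {set vec}) : (#|~: X| <= #|vec|)%N by apply: max_card.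
have [->|nY] := eqVneq Y setT.
  rewrite big1 ?addr0; last first.
    by move=> X /andP[/andP[_]]; rewrite subTset => /eqP->; rewrite eqxx.
  by rewrite /mobius /= eqxx.
rewrite {1}/mobius /= (negPf nY) addrC; apply/eqP; rewrite subr_eq0; apply/eqP.
apply: eq_big => [X|X /andP[/andP[LX sYX] neX]].
  by rewrite properEneq (eq_sym Y) -andbA [(Y \subset X) && _]andbC.
apply: mobius_rec_fuel; first by rewrite ltnS.
apply: leq_trans (cardC Y); apply: proper_card.
by rewrite properC properEneq eq_sym neX.
Qed.

Lemma lattice_subspace (X : {set vec}) :
  is_arrangement A -> X \in L -> exists U : {vspace vec}, X = [set v | v \in U].
Proof.
move=> arrA /imsetP[B]; rewrite powersetE => /subsetP sBA ->.
elim/big_ind: _ => [|_ _ [U ->] [W ->]|H BH].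
- by exists fullv; apply/setP=> v; rewrite !inE memvf.
- by exists (U :&: W)%VS; apply/setP=> v; rewrite !inE memv_cap.
- by have [U [_ ->]] := arrA H (sBA H BH); exists U.
Qed.

Lemma card_lattice (X : {set vec}) :
  is_arrangement A -> X \in L -> #|X| = (#|F| ^ sdim X)%N.
Proof.
move=> arrA /(lattice_subspace arrA)[U defX].
have -> : sdim X = \dim U.
  rewrite /sdim; congr (\dim _); apply/eqP; rewrite eqEsubv; apply/andP; split.
    by apply/span_subvP=> v; rewrite mem_enum defX inE.
  apply/subvP=> v Uv; apply: memv_span.
  by rewrite mem_enum defX inE.
rewrite defX cardsE.
exact: (@card_vspace F (vec : finType) (Vector.class vec) U).
Qed.

Definition tuple_closure k (f : {ffun 'I_k -> vec}) : {set vec} :=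
  \bigcap_(H in [set H in A | [forall i, f i \in H]]) H.

Lemma tuple_closure_in_lattice k (f : {ffun 'I_k -> vec}) :
  tuple_closure f \in L.
Proof.
apply/imsetP; exists [set H in A | [forall i, f i \in H]] => //.
by rewrite powersetE; apply/subsetP=> H; rewrite inE => /andP[].
Qed.

Lemma tuple_closure_sub k (f : {ffun 'I_k -> vec}) (X : {set vec}) :
  X \in L -> (tuple_closure f \subset X) = (f \in ffun_on (mem X)).
Proof.
move=> LX; apply/subsetP/ffun_onP => [sX i|fX v].
  by apply: sX; apply/bigcapP=> H; rewrite inE => /andP[_ /forallP].
case/imsetP: LX fX => B; rewrite powersetE => /subsetP sBA -> fX.
move/bigcapP => cv; apply/bigcapP=> H BH; apply: cv; rewrite inE sBA //=.
by apply/forallP=> i; have /bigcapP := fX i; apply.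
Qed.

(* Moebius inversion over the smallest flat containing a tuple. *)
Lemma char_poly_count (k : nat) : is_arrangement A ->
  (arr_char_poly A).[((#|F| ^ k)%N)%:Z] =
  #|[set f : {ffun 'I_k -> vec} | tuple_closure f == setT]|%:R.
Proof.
move=> arrA; rewrite /arr_char_poly horner_sum -sum1dep_card natr_sum.
transitivity (\sum_(X in L)
   \sum_(f : {ffun 'I_k -> vec} | tuple_closure f \subset X) mobius A X).
  apply: eq_bigr => X LX; rewrite sumr_const hornerZ hornerXn.
  rewrite (eq_card (B := mem (ffun_on (mem X)))); last first.
    by move=> f; apply: tuple_closure_sub.
  rewrite card_ffun_on card_ord card_lattice // -mulr_natr; congr (_ * _).
  by rewrite -natz -natrX -!expnM mulnC.
rewrite (exchange_big_dep xpredT) //= [RHS]big_mkcond /=.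
apply: eq_bigr => f _; rewrite mobius_sum ?tuple_closure_in_lattice //.
by case: eqP.
Qed.

Lemma char_poly_root (k : nat) : is_arrangement A ->
  (arr_char_poly A).[((#|F| ^ k)%N)%:Z] = 0 ->
  forall f : 'I_k -> vec, exists2 H, H \in A & forall i, f i \in H.
Proof.
move=> arrA; rewrite char_poly_count // => /eqP.
rewrite pnatr_eq0 cards_eq0 => /eqP/setP no f.
have := no (finfun f); rewrite inE in_set0 => /negbT ncl.
have [/existsP[H /andP[AH /forallP fH]]|/existsPn noH] :=
  boolP [exists H, (H \in A) && [forall i, finfun f i \in H]].
  by exists H => // i; have := fH i; rewrite ffunE.
case/negP: ncl; rewrite /tuple_closure big_pred0 // => H.
by rewrite inE; apply/negbTE.
Qed.

End CharPoly.

(** * Substitutions and divisibility by linear forms *)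

Section LinearForms.
Variables (F : finFieldType) (l : nat).

Local Notation vec := 'rV[F]_l.
Local Notation S := {mpoly F[l]}.

Lemma linform_is_linear : linear (@linform F l).
Proof.
move=> k a b; rewrite /linform scaler_sumr -big_split /=.
by apply: eq_bigr => i _; rewrite !mxE scalerDl scalerA.
Qed.
HB.instance Definition _ :=
  GRing.isLinear.Build F vec S _ (@linform F l) linform_is_linear.

Lemma linform_coef (a : vec) i : (linform a)@_U_(i) = a 0 i.
Proof.
rewrite /linform raddf_sum (bigD1 i) //= big1 ?addr0 => [|j neji].
  by rewrite mcoeffZ mcoeffXU eqxx mulr1.
by rewrite mcoeffZ mcoeffXU (negPf neji) mulr0.
Qed.

Lemma linform_inj : injective (@linform F l).
Proof. by move=> a b eqab; apply/rowP=> i; rewrite -!linform_coef eqab. Qed.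

Lemma linform_eq0 (a : vec) : (linform a == 0) = (a == 0).
Proof. by rewrite -(inj_eq linform_inj) linear0. Qed.

Lemma linform_delta i : linform (delta_mx 0 i : vec) = 'X_i.
Proof.
rewrite /linform (bigD1 i) //= big1 ?addr0 ?mxE ?eqxx ?scale1r // => j neji.
by rewrite mxE (negPf neji) andbF scale0r.
Qed.

Lemma der_apply_linform (theta : 'rV[S]_l) (a : vec) :
  der_apply theta (linform a) = \sum_i a 0 i *: theta 0 i.
Proof.
apply: eq_bigr => i _; rewrite -mul_mpolyC mulrC; congr (_ * _).
rewrite /linform linear_sum (bigD1 i) //= big1 => [|j neji].
  by rewrite mderivZ mderivX mnm1E eqxx scale1r -{1}[U_(i)%MM]add0m addmK mpolyX0 addr0 alg_mpolyC.
by rewrite mderivZ mderivX mnm1E (negPf neji) scale0r scaler0.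
Qed.

Definition subst (E : 'M[F]_l) (p : S) : S :=
  p \mPo [tuple linform (row i E) | i < l].

HB.instance Definition _ E := GRing.RMorphism.copy (subst E)
  (comp_mpoly [tuple linform (row i E) | i < l]).
HB.instance Definition _ E := GRing.Linear.copy (subst E)
  (comp_mpoly [tuple linform (row i E) | i < l]).

Lemma substX E i : subst E 'X_i = linform (row i E).
Proof. by rewrite /subst comp_mpolyXU -tnth_nth tnth_mktuple. Qed.

Lemma subst_linform E (a : vec) : subst E (linform a) = linform (a *m E).
Proof.
rewrite {1}/linform linear_sum mulmx_sum_row linear_sum /=.
by apply: eq_bigr => i _; rewrite linearZ linearZ /= substX.
Qed.

Definition divides_by_form (a : vec) (p : S) : Prop := exists g, p = linform a * g.

(* Projection of the dual space along [a] onto the forms without [x_c];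
   substituting it restricts polynomials to the hyperplane [a = 0]. *)
Definition elim_mx (a : vec) (c : 'I_l) : 'M[F]_l :=
  \matrix_(i, j) ((i == j)%:R - (i == c)%:R * (a 0 j / a 0 c)).

Lemma mul_elim_mx (a b : vec) c : b *m elim_mx a c = b - (b 0 c / a 0 c) *: a.
Proof.
apply/rowP=> j; rewrite !mxE.
under eq_bigr => i _ do rewrite mxE mulrBr.
rewrite big_split /= (bigD1 j) //= eqxx mulr1 big1 ?addr0 => [|i /negPf->]; last first.
  by rewrite mulr0.
congr (_ + _); rewrite (bigD1 c) //= eqxx mul1r big1 ?addr0 => [|i /negPf->].
  by rewrite mulrCA mulrC -mulrA.
by rewrite mul0r mulr0 oppr0.
Qed.

Lemma mul_elim_mxE (a b : vec) c i :
  (b *m elim_mx a c) 0 i = b 0 i - b 0 c / a 0 c * a 0 i.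
Proof. by rewrite mul_elim_mx !mxE. Qed.

Lemma row_elim_mx (a : vec) c i :
  row i (elim_mx a c) = delta_mx 0 i - ((i == c)%:R / a 0 c) *: a.
Proof. by rewrite rowE mul_elim_mx mxE eqxx /= eq_sym. Qed.

Lemma elim_mx_id (a b : vec) c : b 0 c = 0 -> b *m elim_mx a c = b.
Proof. by move=> bc0; rewrite mul_elim_mx bc0 mul0r scale0r subr0. Qed.

Lemma elim_mx_eq0 (a b : vec) c :
  b *m elim_mx a c = 0 -> b = (b 0 c / a 0 c) *: a.
Proof. by rewrite mul_elim_mx => /eqP; rewrite subr_eq0 => /eqP. Qed.

Lemma mul_elim_mx0 (a : vec) c : a 0 c != 0 -> a *m elim_mx a c = 0.
Proof. by move=> ac; rewrite mul_elim_mx divff // scale1r subrr. Qed.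

Lemma subst_elim_mod (a : vec) c f :
  divides_by_form a (f - subst (elim_mx a c) f).
Proof.
have dv0 : divides_by_form a 0 by exists 0; rewrite mulr0.
have dvD p q : divides_by_form a p -> divides_by_form a q ->
    divides_by_form a (p + q).
  by move=> [g ->] [h ->]; exists (g + h); rewrite mulrDr.
have dvZ p q : divides_by_form a p -> divides_by_form a (q * p).
  by move=> [g ->]; exists (q * g); rewrite mulrCA.
set s := subst _; pose P q := divides_by_form a (q - s q).
have PM p r : P p -> P r -> P (p * r).
  move=> Pp Pr; rewrite /P [s _]rmorphM /=.
  have -> : p * r - s p * s r = r * (p - s p) + s p * (r - s r).
    by rewrite !mulrBr (mulrC r p) (mulrC r (s p)) addrA subrK.
  exact: (dvD _ _ (dvZ _ r Pp) (dvZ _ (s p) Pr)).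
have P1 : P 1 by rewrite /P [s _]rmorph1 subrr.
have PX i : P 'X_i.
  rewrite /P /s substX row_elim_mx linearB linearZ /= linform_delta opprB addrC subrK.
  exists ((i == c)%:R / a 0 c)%:MP.
  by rewrite [linform a * _]mulrC mul_mpolyC.
elim/mpolyind: f => [|k m r _ _ IHr]; first by rewrite [s _]linear0 subrr.
rewrite /s linearD linearZ /= -/s opprD addrACA; apply: dvD => //.
rewrite -scalerBr -mul_mpolyC; apply: dvZ; rewrite -/(P _) mpolyXE_id.
apply: (big_ind P); [exact: P1 | exact: PM | move=> i _].
elim: (m i) => [|e IHe]; first by rewrite expr0.
by rewrite exprS; exact: PM (PX i) IHe.
Qed.

Lemma divides_by_formP (a : vec) c p : a 0 c != 0 ->
  divides_by_form a p <-> subst (elim_mx a c) p = 0.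
Proof.
move=> ac; split=> [[g ->]|p0].
  by rewrite rmorphM /= subst_linform mul_elim_mx0 // linear0 mul0r.
by have := subst_elim_mod a c p; rewrite p0 subr0.
Qed.

Lemma form_neq0P (a : vec) : a != 0 -> exists c, a 0 c != 0.
Proof.
move=> a0; apply/existsP; rewrite -negb_forall; apply: contra a0.
by move/forallP=> a0; apply/eqP/rowP=> i; rewrite mxE; apply/eqP.
Qed.

Lemma form_prime (a : vec) p q : a != 0 -> divides_by_form a (p * q) ->
  divides_by_form a p \/ divides_by_form a q.
Proof.
move=> /form_neq0P[c ac] /(divides_by_formP _ ac)/eqP.
by rewrite rmorphM mulf_eq0 => /orP[]/eqP/(divides_by_formP _ ac); [left | right].
Qed.

Lemma form_divides_form (a b : vec) : a != 0 ->
  divides_by_form a (linform b) -> exists k, b = k *: a.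
Proof.
move=> /form_neq0P[c ac] /(divides_by_formP _ ac)/eqP.
rewrite subst_linform linform_eq0 => /eqP/elim_mx_eq0 ->; by exists (b 0 c / a 0 c).
Qed.

Definition nonproportional (s : seq vec) : Prop :=
  {in s &, forall a b k, b = k *: a -> a = b}.

Lemma prod_forms_divide (s : seq vec) p :
  uniq s -> 0 \notin s -> nonproportional s ->
  (forall a, a \in s -> divides_by_form a p) ->
  exists g, p = (\prod_(a <- s) linform a) * g.
Proof.
elim: s => [|a s IHs] /=; first by exists p; rewrite big_nil mul1r.
case/andP=> as' us; rewrite inE negb_or eq_sym => /andP[a0 s0] nps dvp.
have [|b bs|g defp] := IHs us s0.
- by move=> b c bs cs; apply: nps; rewrite inE ?bs ?cs orbT.
- by apply: dvp; rewrite inE bs orbT.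
have dvb b : b \in s -> ~ divides_by_form a (linform b).
  move=> bs /(form_divides_form a0)[k /(nps a b)]; rewrite !inE eqxx bs orbT.
  by move/(_ isT isT) => eab; rewrite eab bs in as'.
suff [h eqg] : divides_by_form a g.
  by exists h; rewrite big_cons defp eqg mulrA (mulrC (\prod_(_ <- _) _)).
have := dvp a (mem_head _ _); rewrite {IHs dvp}defp.
elim: s {us s0 nps as'} dvb => [|b s IHs] dvb; first by rewrite big_nil mul1r.
rewrite big_cons -mulrA => /(form_prime a0)[/dvb[]|]; first exact: mem_head.
by apply: IHs => c cs; apply: dvb; rewrite inE cs orbT.
Qed.

End LinearForms.

(** * Moore determinants *)

Section Frobenius.
Variables (F : finFieldType) (m : nat).

Local Notation S := {mpoly F[m]}.
Local Notation q := #|F|.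

Lemma frobeniusD r (x y : S) : (x + y) ^+ (q ^ r) = x ^+ (q ^ r) + y ^+ (q ^ r).
Proof.
have [p pr_p pcharFp] := finPcharP F.
apply: exprDn_pchar; rewrite (card_pprimeChar pcharFp) -expnM.
by rewrite pnatX pnatE // pchar_lalg pcharFp.
Qed.

Lemma frobeniusZ r k (x : S) : (k *: x) ^+ (q ^ r) = k *: x ^+ (q ^ r).
Proof.
rewrite exprZn; congr (_ *: _).
by elim: r => [|r IHr]; rewrite ?expr1 // expnSr exprM IHr expf_card.
Qed.

Lemma frobenius_sum r (I : Type) (s : seq I) (P : pred I) (f : I -> S) :
  (\sum_(i <- s | P i) f i) ^+ (q ^ r) = \sum_(i <- s | P i) f i ^+ (q ^ r).
Proof.
apply: (big_morph (fun x : S => x ^+ (q ^ r))); first exact: frobeniusD.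
by rewrite expr0n expn_eq0 eqn0Ngt (ltnW (finNzRing_gt1 F)).
Qed.

Lemma prod_field_translates (x y : S) :
  \prod_(k : F) (x + k *: y) = x ^+ q - y ^+ q.-1 * x.
Proof.
have q1 := finNzRing_gt1 F.
have [->|y0] := eqVneq y 0.
  under eq_bigr => k _ do rewrite scaler0 addr0.
  by rewrite prodr_const expr0n -subn1 subn_eq0 leqNgt q1 mul0r subr0.
rewrite (reindex_inj oppr_inj) /=.
pose iota : {rmorphism F -> {fraction S}} := @tofrac S \o @mpolyC m F.
apply/eqP; rewrite -(@tofrac_eq S); apply/eqP; rewrite rmorph_prod rmorphB rmorphM /= 2!rmorphXn /=.
set X := tofrac x; set Y := tofrac y.
have Y0 : Y != 0 by rewrite tofrac_eq0.
have genF : (X / Y) ^+ q - X / Y = \prod_(k : F) (X / Y - iota k).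
  have /(congr1 (fun p => (map_poly iota p).[X / Y])) := finField_genPoly F.
  rewrite rmorphB rmorph_prod rmorphXn /= map_polyX.
  rewrite hornerD hornerN hornerXn hornerX horner_prod => ->.
  apply: eq_bigr => k _.
  by rewrite rmorphB /= map_polyX map_polyC hornerXsubC.
transitivity (\prod_(k : F) (Y * (X / Y - iota k))).
  apply: eq_bigr => k _; rewrite mulrBr mulrCA divff // mulr1 rmorphD scaleNr rmorphN -mul_mpolyC.
  by rewrite rmorphM /= mulrC.
rewrite big_split /= prodr_const -genF mulrBr exprMn mulrCA -exprMn divff // expr1n mulr1.
congr (_ - _); rewrite -{1}(prednK (ltnW q1)) exprSr -mulrA; congr (_ * _).
by rewrite mulrCA divff ?mulr1.
Qed.

End Frobenius.

Section Moore.
Variables (F : finFieldType) (m n : nat) (y : 'I_n -> {mpoly F[m]}).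

Local Notation S := {mpoly F[m]}.
Local Notation q := #|F|.

Definition comb (a : 'rV[F]_n) : S := \sum_i a 0 i *: y i.

Lemma combD a b : comb (a + b) = comb a + comb b.
Proof.
by rewrite -big_split; apply: eq_bigr => i _; rewrite mxE scalerDl.
Qed.

Lemma comb_delta k i : comb (k *: delta_mx 0 i) = k *: y i.
Proof.
rewrite /comb (bigD1 i) //= big1 ?addr0 => [|j neji].
  by rewrite !mxE !eqxx mulr1.
by rewrite !mxE (negPf neji) andbF mulr0 scale0r.
Qed.

Definition supp_below (r : nat) (a : 'rV[F]_n) : bool :=
  [forall i : 'I_n, (r <= i)%N ==> (a 0 i == 0)].

Definition span_prod (r : nat) (t : S) : S :=
  \prod_(a | supp_below r a) (t + comb a).

Lemma span_prod0 t : span_prod 0 t = t.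
Proof.
rewrite /span_prod (big_pred1 0) => [|a].
  by rewrite /comb big1 ?addr0 // => i _; rewrite mxE scale0r.
apply/forallP/eqP => [a0|-> i]; last by rewrite mxE eqxx implybT.
by apply/rowP=> i; rewrite mxE; apply/eqP; have := a0 i.
Qed.

Lemma span_prodS (j : 'I_n) t :
  span_prod j.+1 t = \prod_(k : F) span_prod j (t + k *: y j).
Proof.
rewrite /span_prod (partition_big (fun a : 'rV[F]_n => a 0 j) xpredT) //=.
apply: eq_bigr => k _; rewrite (reindex_inj (addIr (k *: delta_mx 0 j))) /=.
apply: eq_big => [a|a _]; last by rewrite combD comb_delta -addrA [comb a + _]addrC.
rewrite !mxE !eqxx mulr1.
apply/andP/forallP => [[/forallP sa /eqP]|sa].
  move/(canRL (addrK _)); rewrite subrr => aj i; apply/implyP.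
  rewrite leq_eqVlt => /orP[/eqP/val_inj<-|ltji]; first by rewrite aj.
  have /negPf nij : i != j by rewrite -val_eqE gtn_eqF.
  by have := sa i; rewrite ltji !mxE eqxx nij mulr0 addr0.
split; last by have := sa j; rewrite leqnn => /eqP->; rewrite add0r.
apply/forallP=> i; apply/implyP => ltji.
have /negPf nij : i != j by rewrite -val_eqE gtn_eqF.
by have := sa i; rewrite (ltnW ltji) => /eqP ai; rewrite !mxE ai nij mulr0 addr0.
Qed.

Lemma span_prod_qpoly r : (r <= n)%N -> exists k : nat -> S,
  k r = 1 /\ forall t, span_prod r t = \sum_(s < r.+1) k s * t ^+ (q ^ s).
Proof.
elim: r => [_|r IHr ltrn].
  exists (fun=> 1); split=> // t.
  by rewrite span_prod0 big_ord1 mul1r.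
have [k [kr defQ]] := IHr (ltnW ltrn).
pose j := Ordinal ltrn; pose e := span_prod r (y j) ^+ q.-1.
have recQ t : span_prod r.+1 t = span_prod r t ^+ q - e * span_prod r t.
  rewrite (span_prodS j) -prod_field_translates; apply: eq_bigr => c _.
  rewrite !defQ scaler_sumr -big_split; apply: eq_bigr => s _ /=.
  by rewrite frobeniusD frobeniusZ mulrDr scalerAr.
exists (fun s => (if s is s'.+1 then k s' ^+ q else 0)
               - (if (s <= r)%N then e * k s else 0)).
rewrite ltnn kr expr1n subr0; split=> // t; rewrite recQ.
under [RHS]eq_bigr => s _ do rewrite mulrBl.
rewrite sumrB; congr (_ - _).
  rewrite big_ord_recl /= mul0r add0r defQ -{2}[q]expn1 frobenius_sum.
  apply: eq_bigr => s _.
  by rewrite exprMn -exprM -expnD addn1 expn1.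
rewrite big_ord_recr /= ltnn mul0r addr0 defQ mulr_sumr.
by apply: eq_bigr => s _; rewrite -ltnS ltn_ord mulrA.
Qed.

Lemma span_prod_eq0 (r : nat) (c : 'I_n) : (c < r)%N -> span_prod r (y c) = 0.
Proof.
move=> ltcr; rewrite /span_prod (bigD1 (- 1 *: delta_mx 0 c)) /=.
  by rewrite comb_delta scaleN1r subrr mul0r.
apply/forallP=> i; apply/implyP => leri; rewrite !mxE eqxx /=.
by have /negPf-> : i != c; rewrite ?mulr0 // -val_eqE gtn_eqF // (leq_trans ltcr).
Qed.

Definition moore : 'M[S]_n := \matrix_(r, c) y c ^+ (q ^ r).

(* [span_prod r] is a monic q-polynomial of q-degree [r] killing the first [r]
   entries of [y], so row operations make the Moore matrix triangular. *)
Lemma det_moore_span : \det moore = \prod_(r < n) span_prod r (y r).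
Proof.
have /fin_all_exists[k kP] (r : 'I_n) := span_prod_qpoly (ltnW (ltn_ord r)).
pose K : 'M[S]_n := \matrix_(r, s) (if (s <= r)%N then k r s else 0).
have detK : \det K = 1.
  rewrite det_trig; first by rewrite big1 // => r _; rewrite mxE leqnn; case: (kP r).
  by apply/is_trig_mxP=> r s ltrs; rewrite mxE leqNgt ltrs.
have defKM : K *m moore = \matrix_(r, c) span_prod r (y c).
  apply/matrixP=> r c; rewrite !mxE; case: (kP r) => _ ->.
  rewrite (big_ord_widen n (fun s => k r s * y c ^+ (q ^ s))) // [RHS]big_mkcond /=.
  apply: eq_bigr => s _; rewrite !mxE ltnS.
  by case: ifP => // _; rewrite mul0r.
have -> : \det moore = \det (K *m moore) by rewrite det_mulmx detK mul1r.
rewrite defKM -det_tr det_trig.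
  by apply: eq_bigr => r _; rewrite !mxE.
by apply/is_trig_mxP=> c r ltcr; rewrite !mxE span_prod_eq0.
Qed.

End Moore.

Section Normalized.
Variable (F : finFieldType).

Definition lead_at n (r : 'I_n) (a : 'rV[F]_n) : bool :=
  (a 0 r == 1) && [forall i : 'I_n, (r < i)%N ==> (a 0 i == 0)].

Definition normalized n (a : 'rV[F]_n) : bool := [exists r, lead_at r a].

Lemma lead_at_uniq n (r s : 'I_n) (a : 'rV[F]_n) : lead_at r a -> lead_at s a -> r = s.
Proof.
move=> /andP[/eqP ar /forallP ra] /andP[/eqP as1 /forallP sa].
apply: val_inj; case: (ltngtP r s) => // [lt|lt].
  by have := ra s; rewrite lt as1 oner_eq0.
by have := sa r; rewrite lt ar oner_eq0.
Qed.

Lemma det_moore m n (y : 'I_n -> {mpoly F[m]}) :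
  \det (moore y) = \prod_(a | normalized a) comb y a.
Proof.
rewrite det_moore_span.
transitivity (\prod_(r < n) \prod_(a | lead_at r a) comb y a).
  apply: eq_bigr => r _; rewrite /span_prod.
  rewrite [RHS](reindex_inj (addIr (delta_mx 0 r))) /=.
  apply: eq_big => [a|a _]; last first.
    by rewrite combD -[delta_mx 0 r]scale1r comb_delta scale1r addrC.
  rewrite /lead_at !mxE !eqxx.
  apply/forallP/andP => [sa|[/eqP ar /forallP sa] i].
    split; first by have := sa r; rewrite leqnn => /eqP->; rewrite add0r.
    apply/forallP=> i; apply/implyP => ltri.
    have /negPf nir : i != r by rewrite -val_eqE gtn_eqF.
    by have := sa i; rewrite (ltnW ltri) => /eqP ai; rewrite !mxE ai nir andbF addr0.
  apply/implyP; rewrite leq_eqVlt => /orP[/eqP/val_inj<-|ltri].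
    by move/(canRL (addrK _)): ar => ->; rewrite subrr.
  have /negPf nir : i != r by rewrite -val_eqE gtn_eqF.
  by have := sa i; rewrite ltri !mxE eqxx nir addr0.
rewrite (exchange_big_dep (@normalized n)) /=; last first.
  by move=> r a _ ra; apply/existsP; exists r.
apply: eq_bigr => a /existsP[r ra]; rewrite (big_pred1 r) // => s /=.
by apply/idP/eqP => [sa|-> //]; apply: lead_at_uniq sa ra.
Qed.

Definition insert0 n (j : 'I_n.+1) (b : 'rV[F]_n) : 'rV[F]_n.+1 :=
  \row_i oapp (b 0) 0 (unlift j i).

Lemma insert0_lift n (j : 'I_n.+1) b i : insert0 j b 0 (lift j i) = b 0 i.
Proof. by rewrite mxE liftK. Qed.

Lemma insert0_self n (j : 'I_n.+1) b : insert0 j b 0 j = 0.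
Proof. by rewrite mxE unlift_none. Qed.

Lemma lead_at_insert0 n (j : 'I_n.+1) r b :
  lead_at (lift j r) (insert0 j b) = lead_at r b.
Proof.
rewrite /lead_at insert0_lift; congr (_ && _).
have lt_lift (i k : 'I_n) : (lift j i < lift j k)%N = (i < k)%N.
  by rewrite /= ltnNge leq_bump2 -ltnNge.
apply/forallP/forallP=> sb i.
  by have := sb (lift j i); rewrite lt_lift insert0_lift.
case: (unliftP j i) => [k|] ->; last by rewrite insert0_self eqxx implybT.
by rewrite lt_lift insert0_lift.
Qed.

Lemma normalized_insert0 n (j : 'I_n.+1) b :
  normalized (insert0 j b) = normalized b.
Proof.
apply/existsP/existsP => [[r]|[r rb]]; last by exists (lift j r); rewrite lead_at_insert0.
case: (unliftP j r) => [k|] ->; first by rewrite lead_at_insert0; exists k.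
by rewrite /lead_at insert0_self eq_sym oner_eq0.
Qed.

Lemma det_moore_omit n (j : 'I_n.+1) :
  \det (moore (fun c => 'X_(lift j c) : {mpoly F[n.+1]})) =
  \prod_(a : 'rV[F]_n.+1 | normalized a && (a 0 j == 0)) linform a.
Proof.
rewrite det_moore [RHS](reindex_onto (insert0 j) (@col' _ _ _ j)) /= => [|a /andP[_ /eqP aj]].
  apply: eq_big => [b|b _].
    rewrite normalized_insert0 insert0_self eqxx andbT.
    suff -> : col' j (insert0 j b) = b by rewrite eqxx andbT.
    by apply/rowP=> i; rewrite mxE insert0_lift.
  rewrite /linform (bigD1_ord j) //= insert0_self scale0r add0r.
  by apply: eq_bigr => i _; rewrite insert0_lift.
apply/rowP=> i; case: (unliftP j i) => [k|] ->; last by rewrite insert0_self.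
by rewrite insert0_lift mxE.
Qed.

End Normalized.

(** * Polynomials vanishing on the rational subspaces of codimension 2 *)

Section Codim2.
Variables (F : finFieldType) (n : nat).

Local Notation l := n.+1.
Local Notation vec := 'rV[F]_l.
Local Notation S := {mpoly F[l]}.

Definition omit_prod (j : 'I_l) : S :=
  \prod_(a : vec | normalized a && (a 0 j == 0)) linform a.

Definition in_omit_ideal (f : S) : Prop :=
  exists h : 'I_l -> S, f = \sum_j h j * omit_prod j.

Lemma lead_at_eq1 (r : 'I_l) (a : vec) : lead_at r a -> a 0 r = 1.
Proof. by case/andP=> /eqP. Qed.

Lemma lead_at_eq0 (r i : 'I_l) (a : vec) : lead_at r a -> (r < i)%N -> a 0 i = 0.
Proof. by case/andP=> _ /forallP/(_ i)/implyP ra /ra/eqP. Qed.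

Lemma lead_at_le (r i : 'I_l) (a : vec) : lead_at r a -> a 0 i != 0 -> (i <= r)%N.
Proof. by move=> ra; rewrite leqNgt; apply: contra => /(lead_at_eq0 ra)->. Qed.

Lemma lead_at_scale (r s : 'I_l) k (a : vec) :
  lead_at r a -> lead_at s (k *: a) -> k = 1.
Proof.
move=> ra sb; have := lead_at_eq1 sb; rewrite mxE => kas.
have k0 : k != 0 by apply/eqP=> k0; move/eqP: kas; rewrite k0 mul0r eq_sym oner_eq0.
have as0 : a 0 s != 0 by apply/eqP=> as0; move/eqP: kas; rewrite as0 mulr0 eq_sym oner_eq0.
have le_sr := lead_at_le ra as0.
have le_rs : (r <= s)%N by apply: (lead_at_le sb); rewrite mxE (lead_at_eq1 ra) mulr1.
have ers : r = s by apply/val_inj/eqP; rewrite eqn_leq le_rs.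
by rewrite -kas -ers (lead_at_eq1 ra) mulr1.
Qed.

Lemma lead_at_neq0 (r : 'I_l) (a : vec) : lead_at r a -> a != 0.
Proof. by move/lead_at_eq1; apply: contra_eq_neq => ->; rewrite mxE eq_sym oner_neq0. Qed.

Definition below (j : nat) : {set vec} :=
  [set a | [exists r : 'I_l, (r < j)%N && lead_at r a]].

Lemma belowP j (a : vec) :
  reflect (exists2 r : 'I_l, (r < j)%N & lead_at r a) (a \in below j).
Proof.
rewrite inE; apply: (iffP existsP) => [[r /andP[]]|[r ltrj ra]].
  by exists r.
by exists r; rewrite ltrj.
Qed.

Definition above_omit (j : 'I_l) : {set vec} :=
  [set b | [exists r : 'I_l, (j < r)%N && lead_at r b] && (b 0 j == 0)].

Lemma above_omitP (j : 'I_l) (b : vec) :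
  reflect (exists r : 'I_l, [/\ (j < r)%N, lead_at r b & b 0 j = 0])
          (b \in above_omit j).
Proof.
rewrite inE; apply: (iffP andP) => [[/existsP[r /andP[ltjr rb]] /eqP b0]|].
  by exists r.
case=> r [ltjr rb ->]; split=> //; apply/existsP; exists r.
by rewrite ltjr.
Qed.

Lemma omit_prod_split (j : 'I_l) :
  omit_prod j = (\prod_(a in below j) linform a) * \prod_(a in above_omit j) linform a.
Proof.
rewrite /omit_prod (bigID (fun a => a \in below j)) /=; congr (_ * _).
  apply: eq_bigl => a; apply/andP/idP => [[]//|aj]; split=> //.
  have /belowP[r ltrj ra] := aj.
  by rewrite (lead_at_eq0 ra) // eqxx andbT; apply/existsP; exists r.
apply: eq_bigl => a; apply/idP/idP=> [/andP[/andP[/existsP[r ra] /eqP aj] naj]|].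
  apply/above_omitP; exists r; split=> //.
  rewrite ltnNge leq_eqVlt; apply/norP; split.
    apply/eqP=> /val_inj erj; move/eqP: aj.
    by rewrite -erj (lead_at_eq1 ra) oner_eq0.
  by apply: contra naj => ltrj; apply/belowP; exists r.
case/above_omitP=> r [ltjr ra ->]; rewrite eqxx andbT.
apply/andP; split; first by apply/existsP; exists r.
apply/belowP => -[s ltsj sa]; rewrite (lead_at_uniq sa ra) in ltsj.
by have := ltn_trans ltsj ltjr; rewrite ltnn.
Qed.

(* Reduced echelon bases of the planes of forms, i.e. the rational subspaces
   of codimension 2. *)
Definition reduced_pair (c d : vec) (j k : 'I_l) : Prop :=
  [/\ lead_at j c, lead_at k d, (j < k)%N & d 0 j = 0].

Definition subst_pair (c d : vec) (j k : 'I_l) (f : S) : S :=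
  subst (elim_mx d k) (subst (elim_mx c j) f).

Definition in_span_pair (c d : vec) (j k : 'I_l) (a : vec) : Prop :=
  a *m elim_mx c j *m elim_mx d k = 0.

Lemma subst_pairD c d j k : {morph subst_pair c d j k : f g / f + g}.
Proof. by move=> f g; rewrite /subst_pair (rmorphD (subst _)) (rmorphD (subst _)). Qed.

Lemma subst_pairM c d j k : {morph subst_pair c d j k : f g / f * g}.
Proof. by move=> f g; rewrite /subst_pair (rmorphM (subst _)) (rmorphM (subst _)). Qed.

Lemma subst_pair_linform (c d : vec) j k (a : vec) :
  subst_pair c d j k (linform a) = linform (a *m elim_mx c j *m elim_mx d k).
Proof. by rewrite /subst_pair !subst_linform. Qed.

Definition vanishes_off (B : {set vec}) (f : S) : Prop :=
  forall c d j k, reduced_pair c d j k ->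
    (forall a, a \in B -> ~ in_span_pair c d j k a) -> subst_pair c d j k f = 0.

Definition peeled (f : S) (B : {set vec}) : Prop :=
  exists g f' : S, [/\ in_omit_ideal g, 
    f = g + (\prod_(a in B) linform a) * f' & vanishes_off B f'].

Lemma in_omit_idealD f g : in_omit_ideal f -> in_omit_ideal g -> in_omit_ideal (f + g).
Proof.
move=> [h ->] [h' ->]; exists (fun j => h j + h' j); rewrite -big_split.
by apply: eq_bigr => j _; rewrite mulrDl.
Qed.

Lemma in_omit_ideal_gen j f : in_omit_ideal (f * omit_prod j).
Proof.
exists (fun i => if i == j then f else 0); rewrite (bigD1 j) //= eqxx big1 ?addr0 //.
by move=> i /negPf->; rewrite mul0r.
Qed.

Lemma in_span_pair_above (c d : vec) j k (i : 'I_l) : reduced_pair c d j k ->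
  (forall a, a \in below i -> ~ in_span_pair c d j k a) ->
  exists2 e, e \in above_omit i & in_span_pair c d j k e.
Proof.
case=> jc kd ltjk dj nbelow.
have sc : in_span_pair c d j k c.
  by rewrite /in_span_pair mul_elim_mx0 ?mul0mx // (lead_at_eq1 jc) oner_eq0.
have sd : in_span_pair c d j k d.
  rewrite /in_span_pair (elim_mx_id _ dj).
  by rewrite mul_elim_mx0 // (lead_at_eq1 kd) oner_eq0.
have [e [r re] [ei se]] :
    exists e : vec, exists2 r : 'I_l, lead_at r e & e 0 i = 0 /\ in_span_pair c d j k e.
  have [ci|ci] := eqVneq (c 0 i) 0; first by exists c, j.
  exists (d - (d 0 i / c 0 i) *: c), k; last split.
  - apply/andP; split.
      by rewrite !mxE (lead_at_eq1 kd) (lead_at_eq0 jc ltjk) mulr0 subr0.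
    apply/forallP=> s; apply/implyP=> ltks; rewrite !mxE (lead_at_eq0 kd ltks).
    by rewrite (lead_at_eq0 jc (ltn_trans ltjk ltks)) mulr0 subr0.
  - by rewrite !mxE divfK ?subrr.
  - rewrite /in_span_pair !mulmxBl -!scalemxAl.
    by move: sc sd; rewrite /in_span_pair => -> ->; rewrite scaler0 subr0.
exists e => //; apply/above_omitP; exists r; split=> //.
rewrite ltnNge leq_eqVlt; apply/norP; split; apply/negP.
  move=> /eqP/val_inj eri; move/eqP: ei.
  by rewrite -eri (lead_at_eq1 re) oner_eq0.
by move=> ltri; apply: (nbelow e) => //; apply/belowP; exists r.
Qed.

(* Restricted to the hyperplane [a = 0], the cofactor [f'] vanishes on every
   codimension 2 subspace of it that no form of [B] contains, so it is a
   multiple of the product over [above_omit j]; times the product over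
   [below j], which divides that of [B], this is [omit_prod j]. *)
Lemma peel_one (f : S) (B : {set vec}) (j : 'I_l) (a : vec) :
  lead_at j a -> a \notin B -> below j \subset B -> B \subset below j.+1 ->
  peeled f B -> peeled f (a |: B).
Proof.
move=> ja aB /subsetP sjB /subsetP sBj [g [f' [Ig deff vanf]]].
have aj : a 0 j != 0 by rewrite (lead_at_eq1 ja) oner_eq0.
set p := subst (elim_mx a j) f'.
pose u := \prod_(b in above_omit j) linform b.
have [h defp] : exists h, p = u * h.
  have leadU b : b \in above_omit j -> exists r : 'I_l, lead_at r b.
    by case/above_omitP=> r [_ rb _]; exists r.
  rewrite /u -big_enum /=.
  apply: prod_forms_divide; first exact: enum_uniq.
  - by rewrite mem_enum; apply/negP=> /leadU[r /lead_at_neq0]; rewrite eqxx.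
  - move=> b c; rewrite !mem_enum => /leadU[r rb] /leadU[s sc] k ec.
    by move: sc; rewrite ec => /(lead_at_scale rb)->; rewrite scale1r.
  move=> b; rewrite mem_enum => /above_omitP[r [ltjr rb bj]].
  have br : b 0 r != 0 by rewrite (lead_at_eq1 rb) oner_eq0.
  apply/(divides_by_formP _ br); apply: (vanf a b j r) => // e eB.
  move/elim_mx_eq0; rewrite mul_elim_mx; set x := _ / a 0 j => /eqP.
  have /sBj/belowP[s ltsj se] := eB.
  rewrite !mxE (lead_at_eq0 ja ltjr) (lead_at_eq0 se) ?(leq_trans ltsj) //.
  rewrite mulr0 subr0 mul0r scale0r subr_eq0 => /eqP ee.
  by move: se; rewrite ee => /(lead_at_scale ja) x1; rewrite ee x1 scale1r (negPf aB) in eB.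
have [f'' deff'] := subst_elim_mod a j f'.
have {}deff' : f' = u * h + linform a * f''.
  by rewrite -deff' -/p defp addrC subrK.
exists (g + (\prod_(b in B :\: below j) linform b * h) * omit_prod j), f''; split.
- by apply: in_omit_idealD => //; apply: in_omit_ideal_gen.
- rewrite deff -addrA; congr (_ + _).
  rewrite big_setU1 //= {1}deff' mulrDr; congr (_ + _); last by rewrite mulrCA mulrA.
  rewrite omit_prod_split -/u (big_setID (below j)) /=.
  have -> : B :&: below j = below j by apply/setIidPr/subsetP.
  by rewrite [RHS]mulrC -!mulrA; congr (_ * _); rewrite mulrCA.
move=> c d i k red naB.
have nB e : e \in B -> ~ in_span_pair c d i k e.
  by move=> eB; apply: naB; rewrite inE eB orbT.
have := vanf c d i k red nB; rewrite deff' subst_pairD !subst_pairM.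
have [e eU se] := in_span_pair_above red (fun e ej => nB e (sjB e ej)).
have -> : subst_pair c d i k u = 0.
  by rewrite /u (bigD1 e) //= subst_pairM subst_pair_linform se linear0 mul0r.
rewrite mul0r add0r subst_pair_linform.
move/eqP; rewrite mulf_eq0 linform_eq0 => /orP[/eqP sa|/eqP//].
by case: (naB a); rewrite ?setU11.
Qed.

Lemma peel_below (f : S) (j : nat) :
  vanishes_off set0 f -> (j <= l)%N -> peeled f (below j).
Proof.
move=> vanf; elim: j => [_|j IHj ltjl].
  have -> : below 0 = set0.
    by apply/setP=> a; rewrite [RHS]inE; apply/belowP=> -[].
  exists 0, f; split=> //; last by rewrite big_set0 mul1r add0r.
  by exists (fun=> 0); rewrite big1 // => i _; rewrite mul0r.
pose i := Ordinal ltjl.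
have peelU (s : seq vec) : all (lead_at i) s -> peeled f (below j :|: [set a in s]).
  elim: s => [_|a s IHs /= /andP[ia si]].
    have -> : [set a in [::]] = set0 :> {set vec} by apply/setP=> a; rewrite !inE.
    by rewrite setU0; apply: IHj (ltnW ltjl).
  have [as_|as_] := boolP (a \in below j :|: [set a in s]).
    have -> : below j :|: [set b in a :: s] = below j :|: [set b in s].
      by rewrite set_cons setUCA; apply/setUidPr; rewrite sub1set.
    exact: IHs.
  rewrite set_cons setUCA; apply: (peel_one ia as_ _ _ (IHs si)).
    exact: subsetUl.
  apply/subsetP=> b; rewrite in_setU => /orP[/belowP[r ltrj rb]|].
    by apply/belowP; exists r => //; apply: leqW.
  by rewrite inE => /(allP si) ib; apply/belowP; exists i => /=.
have := peelU (enum (lead_at i)).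
have -> : below j :|: [set a in enum (lead_at i)] = below j.+1.
  apply/setP=> a; rewrite in_setU [X in _ || X]inE mem_enum; apply/orP/belowP.
  case=> [/belowP[r ltrj ra]|ia].
  - by exists r => //; apply: leqW.
  - by exists i.
  case=> r; rewrite ltnS leq_eqVlt => /orP[/eqP erj ra|ltrj ra].
    by right; have -> : i = r by apply: val_inj.
  by left; apply/belowP; exists r.
by apply; apply/allP=> a; rewrite mem_enum.
Qed.

Lemma vanishing_in_omit_ideal (f : S) :
  (forall c d j k, reduced_pair c d j k -> subst_pair c d j k f = 0) ->
  in_omit_ideal f.
Proof.
move=> vanf.
have [|g [f' [Ig -> _]]] := @peel_below f l _ (leqnn _).
  by move=> c d j k red _; apply: vanf.
apply: in_omit_idealD => //; rewrite (bigID (fun a : vec => a 0 0 == 0)) /=.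
have -> : \prod_(a in below l | a 0 0 == 0) linform a = omit_prod 0.
  apply: eq_bigl => a; congr (_ && _).
  by apply/belowP/existsP=> [[r _ ra]|[r ra]]; exists r.
by rewrite -mulrA mulrC; apply: in_omit_ideal_gen.
Qed.

End Codim2.

(** * Saito's criterion *)

Section Homogeneous.
Variables (F : fieldType) (m : nat).
Local Notation S := {mpoly F[m]}.

Lemma dhomog_prod_sum (I : Type) (s : seq I) (P : pred I) (f : I -> S) (e : I -> nat) :
  (forall i, P i -> f i \is (e i).-homog) ->
  \prod_(i <- s | P i) f i \is (\sum_(i <- s | P i) e i)%N.-homog.
Proof.
move=> fe; apply: (big_ind2 (fun (p : S) d => p \is d.-homog)) => //.
  exact: dhomog1.
by move=> p d p' d'; apply: dhomogM.
Qed.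

Lemma pihomogM (d e : nat) (p f : S) : p \is d.-homog ->
  pihomog mdeg e (p * f) =
  if (d <= e)%N then p * pihomog mdeg (e - d) f else 0.
Proof.
move=> pd; pose k := maxn (msize f) e.+1.
rewrite {1}(pihomog_partitionE (mf := mdeg) (leq_maxl _ _ : (msize f <= k)%N)).
rewrite mulr_sumr linear_sum /=.
have pi_i (i : nat) : pihomog mdeg e (p * pihomog mdeg i f) =
    if (d + i == e)%N then p * pihomog mdeg i f else 0.
  have hi : p * pihomog mdeg i f \is (d + i).-homog.
    by apply: dhomogM => //; apply: pihomogP.
  case: eqP => [<-|/eqP ne]; first exact: pihomog_dE.
  exact: pihomog_ne0 ne hi.
under eq_bigr => i _ do rewrite pi_i.
case: leqP => [le_de|lt_ed].
  have lt_k : (e - d < k)%N by rewrite (leq_trans _ (leq_maxr _ _)) // ltnS leq_subr.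
  rewrite (bigD1 (Ordinal lt_k)) //= subnKC // eqxx big1 ?addr0 // => i nei.
  case: eqP => // die; case/eqP: nei; apply: val_inj => /=.
  by rewrite -die addKn.
rewrite big1 // => i _; case: eqP => // die.
by rewrite -die -ltn_subRL subnn in lt_ed.
Qed.

End Homogeneous.

Section Freeness.
Variables (F : finFieldType) (n : nat).

Local Notation l := n.+1.
Local Notation vec := 'rV[F]_l.
Local Notation S := {mpoly F[l]}.
Local Notation q := #|F|.

Lemma linform_dhomog (a : vec) : linform a \is 1.-homog.
Proof. by apply: rpred_sum => i _; apply: rpredZ; rewrite dhomogX /= mdeg1. Qed.

Lemma omit_prod_dhomog (j : 'I_l) :
  omit_prod F j \is (\sum_(i < n) q ^ i)%N.-homog.
Proof.
rewrite /omit_prod -det_moore_omit; apply: rpred_sum => s _.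
rewrite rpredMsign; apply: dhomog_prod_sum => i _; rewrite mxE.
by rewrite -[X in X.-homog]mul1n; apply: dhomogMn; rewrite dhomogX /= mdeg1.
Qed.

Lemma omit_prod_ndivides (a : vec) (c : 'I_l) :
  a 0 c != 0 -> ~ divides_by_form a (omit_prod F c).
Proof.
move=> ac /(divides_by_formP _ ac)/eqP; apply/negP.
rewrite /omit_prod rmorph_prod /=; apply/prodf_neq0 => b /andP[/existsP[r rb] /eqP bc].
by rewrite subst_linform linform_eq0 elim_mx_id // (lead_at_neq0 rb).
Qed.

Lemma divides_sum (a : vec) (I : Type) (s : seq I) (P : pred I) (f : I -> S) :
  (forall i, P i -> divides_by_form a (f i)) ->
  divides_by_form a (\sum_(i <- s | P i) f i).
Proof.
move=> dvf; apply: (big_ind (divides_by_form a)) => //.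
  by exists 0; rewrite mulr0.
by move=> p p' [g ->] [g' ->]; exists (g + g'); rewrite mulrDr.
Qed.

Lemma divides_mull (a : vec) p f : divides_by_form a f -> divides_by_form a (p * f).
Proof. by case=> g ->; exists (p * g); rewrite mulrCA. Qed.

Lemma divides_scale (a : vec) k f : k != 0 ->
  divides_by_form a (f * k%:MP) -> divides_by_form a f.
Proof.
move=> k0 [g defg]; exists (g * k^-1%:MP).
by rewrite mulrA -defg -mulrA -rmorphM divff // rmorph1 mulr1.
Qed.

Lemma der_apply_adj (N : 'M[S]_l) (a : vec) (c : 'I_l) :
  \sum_r cofactor N r c * der_apply (row r N) (linform a) = \det N * (a 0 c)%:MP.
Proof.
pose av : 'cV[S]_l := \col_i (a 0 i)%:MP.
have defv r : (N *m av) r 0 = der_apply (row r N) (linform a).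
  rewrite der_apply_linform mxE; apply: eq_bigr => i _.
  by rewrite !mxE mulrC mul_mpolyC.
have /(congr1 (fun M : 'cV[S]_l => M c 0)) : \adj N *m (N *m av) = \det N *: av.
  by rewrite mulmxA mul_adj_mx mul_scalar_mx.
rewrite mxE [RHS]mxE [X in _ * X]mxE => <-.
by apply: eq_bigr => r _; rewrite defv mxE.
Qed.

Lemma form_divides_det (N : 'M[S]_l) (a : vec) : a != 0 ->
  (forall r, divides_by_form a (der_apply (row r N) (linform a))) ->
  divides_by_form a (\det N).
Proof.
move=> /form_neq0P[c ac] dvN; apply: (divides_scale ac).
by rewrite -der_apply_adj; apply: divides_sum => r _; apply: divides_mull.
Qed.

Definition saito_mx (theta : 'rV[S]_l) : 'M[S]_l :=
  \matrix_(r, c) (if (r < n)%N then 'X_c ^+ (q ^ r) else theta 0 c).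

Lemma saito_cofactor theta (c : 'I_l) :
  cofactor (saito_mx theta) ord_max c = (-1) ^+ (n + c) * omit_prod F c.
Proof.
rewrite /cofactor /omit_prod -det_moore_omit; congr (_ * \det _).
by apply/matrixP=> r s; rewrite !mxE lift_max ltn_ord.
Qed.

Lemma saito_det theta :
  \det (saito_mx theta) = \sum_c theta 0 c * ((-1) ^+ (n + c) * omit_prod F c).
Proof.
rewrite (expand_det_row _ ord_max); apply: eq_bigr => c _.
by rewrite saito_cofactor mxE ltnn.
Qed.

Lemma frobenius_row_divides theta (r : 'I_l) (a : vec) : (r < n)%N ->
  divides_by_form a (der_apply (row r (saito_mx theta)) (linform a)).
Proof.
move=> ltrn; rewrite der_apply_linform.
have -> : \sum_i a 0 i *: row r (saito_mx theta) 0 i = linform a ^+ (q ^ r).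
  rewrite /linform frobenius_sum; apply: eq_bigr => i _.
  by rewrite frobeniusZ !mxE ltrn.
have q0 : (0 < q ^ r)%N by rewrite expn_gt0 (ltnW (finNzRing_gt1 F)).
by exists (linform a ^+ (q ^ r).-1); rewrite -exprS prednK.
Qed.

(* Along the hyperplane the Frobenius rows are generically independent, so the
   determinant can only vanish there if the last row is tangent too. *)
Lemma last_row_divides theta (a : vec) : a != 0 ->
  divides_by_form a (\det (saito_mx theta)) ->
  divides_by_form a (der_apply theta (linform a)).
Proof.
move=> a0 dvdet; have [c ac] := form_neq0P a0.
have rowT : row ord_max (saito_mx theta) = theta.
  by apply/rowP=> i; rewrite !mxE ltnn.
have : divides_by_form a (omit_prod F c * der_apply theta (linform a)).
  have := der_apply_adj (saito_mx theta) a c.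
  rewrite (bigD1 ord_max) //= rowT saito_cofactor => /(canRL (addrK _)) eqc.
  have [g] : divides_by_form a
     ((-1) ^+ (n + c) * omit_prod F c * der_apply theta (linform a)).
    have [g defg] := dvdet.
    have [g' defg'] : divides_by_form a (\sum_(r < l | r != ord_max)
       cofactor (saito_mx theta) r c * der_apply (row r (saito_mx theta)) (linform a)).
      apply: divides_sum => r ne_r; apply: divides_mull; apply: frobenius_row_divides.
      by rewrite ltn_neqAle -[X in (_ <= X)%N]/n -ltnS ltn_ord andbT; apply: contra ne_r.
    exists (g * (a 0 c)%:MP - g'); rewrite eqc defg defg'.
    by rewrite mulrBr mulrA.
  rewrite -mulrA => /(congr1 (fun p => (-1) ^+ (n + c) * p)).
  rewrite mulrA -expr2 sqrr_sign mul1r => ->.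
  by apply: divides_mull; exists g.
by case/(form_prime a0) => // /(omit_prod_ndivides ac).
Qed.

End Freeness.

Section MainProof.
Variables (F : finFieldType) (n : nat).

Local Notation l := n.+2.
Local Notation vec := 'rV[F]_l.
Local Notation S := {mpoly F[l]}.
Local Notation q := #|F|.

Variables (A : {set {set vec}}) (alpha : {set vec} -> vec).
Hypothesis arrA : is_arrangement A.
Hypothesis alphaP : forall H, H \in A ->
  alpha H != 0 /\ (forall v : vec, (v \in H) = (v *m (alpha H)^T == 0)).
Hypothesis chi0 : (arr_char_poly A).[((q ^ n)%N)%:Z] = 0.

Definition defining_poly : S := \prod_(H in A) linform (alpha H).

Lemma form_in_span_pair c d j k : @reduced_pair F n.+1 c d j k ->
  exists2 H, H \in A & in_span_pair c d j k (alpha H).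
Proof.
case=> jc kd ltjk dj.
case: (unliftP j k) => [k' defk|ekj]; last by rewrite ekj ltnn in ltjk.
pose E := elim_mx c j *m elim_mx d k.
have [H AH fH] := char_poly_root arrA chi0 (fun i => (col (lift j (lift k' i)) E)^T).
have cj1 := lead_at_eq1 jc; have dk1 := lead_at_eq1 kd.
exists H => //; rewrite /in_span_pair; set b := alpha H; apply/rowP=> i; rewrite [RHS]mxE.
case: (unliftP j i) => [i1 ->|->]; last first.
  by rewrite mul_elim_mxE dj mulr0 subr0 mul_elim_mxE cj1 divr1 mulr1 subrr.
case: (unliftP k' i1) => [i2 ->|->]; last first.
  by rewrite -defk mul_elim_mxE dk1 divr1 mulr1 subrr.
have := fH i2; rewrite (alphaP AH).2 -trmx_mul trmx_eq0 -/b => /eqP/matrixP/(_ 0 0).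
rewrite [RHS]mxE => <-; rewrite -mulmxA -/E [LHS]mxE [RHS]mxE.
by apply: eq_bigr => s _; rewrite [col _ _ _ _]mxE.
Qed.

Lemma defining_poly_in_ideal : in_omit_ideal defining_poly.
Proof.
apply: vanishing_in_omit_ideal => c d j k red.
have [H AH sH] := form_in_span_pair red.
by rewrite /defining_poly (bigD1 H) //= subst_pairM subst_pair_linform sH linear0 mul0r.
Qed.

Lemma defining_poly_neq0 : defining_poly != 0.
Proof.
apply/prodf_neq0 => H AH; rewrite linform_eq0.
by have [] := alphaP AH.
Qed.

Lemma defining_poly_dhomog : defining_poly \is #|A|.-homog.
Proof.
rewrite -sum1_card; apply: dhomog_prod_sum => H _; exact: linform_dhomog.
Qed.

Lemma forms_divide_defining (f : S) :
  (forall H, H \in A -> divides_by_form (alpha H) f) ->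
  exists g, f = defining_poly * g.
Proof.
move=> dvf; rewrite /defining_poly -big_enum /= -(big_map alpha predT (@linform F l)).
have prop H H' k : H \in A -> H' \in A -> alpha H' = k *: alpha H -> H = H'.
  move=> AH AH' eqk; have [a0 inH] := alphaP AH; have [a'0 inH'] := alphaP AH'.
  have k0 : k != 0 by apply: contraNneq a'0 => k0; rewrite eqk k0 scale0r.
  apply/setP=> v; rewrite inH inH' eqk linearZ -scalemxAr scaler_eq0.
  by rewrite (negPf k0).
apply: prod_forms_divide.
- rewrite map_inj_in_uniq ?enum_uniq // => H H'; rewrite !mem_enum => AH AH' eqH.
  by apply: (prop _ _ 1); rewrite ?scale1r.
- apply/mapP=> -[H]; rewrite mem_enum => AH.
  by have [/eqP a0 _] := alphaP AH => /esym.
- move=> _ _ /mapP[H + ->] /mapP[H' + ->] k; rewrite !mem_enum => AH AH'.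
  by move/(prop _ _ _ AH AH')->.
- by move=> _ /mapP[H + ->]; rewrite mem_enum => /dvf.
Qed.

Lemma saito_row_exists : exists (d : nat) (theta : 'rV[S]_l),
  [/\ (d + \sum_(i < n.+1) q ^ i)%N = #|A|,
      forall i, theta 0 i \is d.-homog
    & \det (saito_mx theta) = defining_poly].
Proof.
have [h defQ] := defining_poly_in_ideal.
set D := (\sum_(i < n.+1) q ^ i)%N.
have {defQ} := congr1 (pihomog mdeg #|A|) defQ.
rewrite (pihomog_dE defining_poly_dhomog) linear_sum /=.
under eq_bigr => j _ do rewrite mulrC (pihomogM _ _ (omit_prod_dhomog F j)) -/D.
have [leDA defQ|_] := leqP D #|A|; last first.
  by rewrite big1 // => Q0; have := defining_poly_neq0; rewrite Q0 eqxx.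
exists (#|A| - D)%N, (\row_i ((-1) ^+ (n.+1 + i) * pihomog mdeg (#|A| - D) (h i))).
split; first by rewrite subnK.
  by move=> i; rewrite mxE rpredMsign; apply: pihomogP.
rewrite saito_det defQ; apply: eq_bigr => i _.
by rewrite mxE mulrACA -expr2 sqrr_sign mul1r mulrC.
Qed.

Lemma saito_free (d : nat) (theta : 'rV[S]_l) :
  (forall i, theta 0 i \is d.-homog) ->
  \det (saito_mx theta) = defining_poly ->
  free_with_exponents A alpha ([seq (q ^ i)%N | i <- iota 0 n.+1] ++ [:: d]).
Proof.
move=> homt detM; set M := saito_mx theta in detM.
have rowmax : row ord_max M = theta by apply/rowP=> i; rewrite !mxE ltnn.
have inDA j : in_DA A alpha (row j M).
  move=> H AH; have [a0 _] := alphaP AH; rewrite -/(divides_by_form _ _).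
  have [ltjn|] := ltnP j n.+1; first exact: frobenius_row_divides.
  move=> lenj; have -> : j = ord_max.
    by apply/val_inj/eqP; rewrite eqn_leq lenj -ltnS ltn_ord.
  rewrite rowmax; apply: last_row_divides => //; rewrite -/M detM /defining_poly.
  by rewrite (bigD1 H) //=; eexists.
have sumE (c : 'I_l -> S) : \sum_j c j *: row j M = (\row_j c j) *m M.
  by rewrite mulmx_sum_row; apply: eq_bigr => j _; rewrite mxE.
exists (fun j => row j M), (fun j => if (j < n.+1)%N then (q ^ j)%N else d); split=> //.
- move=> j i; rewrite !mxE; case: ifP => // _.
  by rewrite -[X in X.-homog]mul1n; apply: dhomogMn; rewrite dhomogX /= mdeg1.
- move=> c; rewrite sumE => /(congr1 (mulmxr (\adj M))) /=.
  rewrite -mulmxA mul_mx_adj mul0mx mul_mx_scalar detM => /rowP c0 j.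
  have /eqP := c0 j; rewrite !mxE mulf_eq0 (negPf defining_poly_neq0).
  by move/eqP.
- move=> t tDA.
  have dvr (r : 'I_l) : exists g, (t *m \adj M) 0 r = defining_poly * g.
    pose N : 'M[S]_l := \matrix_(i, j) (if i == r then t 0 j else M i j).
    have rowN : row r N = t by apply/rowP=> i; rewrite !mxE eqxx.
    have rowN' i : i != r -> row i N = row i M.
      by move=> neir; apply/rowP=> j; rewrite !mxE (negPf neir).
    have -> : (t *m \adj M) 0 r = \det N.
      rewrite (expand_det_row _ r) mxE; apply: eq_bigr => j _.
      rewrite !mxE eqxx; congr (_ * (_ * \det _)); apply/matrixP=> i k.
      by rewrite !mxE eq_sym (negPf (neq_lift _ _)).
    apply: forms_divide_defining => H AH; have [a0 _] := alphaP AH.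
    apply: form_divides_det => // i; have [->|neir] := eqVneq i r.
      by rewrite rowN; apply: tDA.
    by rewrite rowN' //; apply: inDA.
  have /fin_all_exists[c defc] := dvr.
  exists c; rewrite sumE; apply/eqP.
  suff : defining_poly *: (t - (\row_j c j) *m M) == 0.
    rewrite scalemx_eq0 (negPf defining_poly_neq0) /=.
    by rewrite subr_eq0.
  rewrite scalerBr scalemxAl.
  have -> : defining_poly *: (\row_j c j) = t *m \adj M.
    by apply/rowP=> j; rewrite defc !mxE.
  by rewrite -mulmxA mul_adj_mx detM mul_mx_scalar subrr.
- rewrite (map_comp (fun i => if (i < n.+1)%N then (q ^ i)%N else d) val) val_enum_ord.
  rewrite -[l]addn1 iotaD map_cat [map _ (iota _ 1)]/= ltnn.
  suff /eq_in_map-> : {in iota 0 n.+1,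
      (fun i => if (i < n.+1)%N then (q ^ i)%N else d) =1 (fun i => (q ^ i)%N)} by [].
  by move=> i; rewrite mem_iota add0n /= => ->.
Qed.

End MainProof.

Theorem mainTheorem7 (F : finFieldType) (l : nat)
  (A : {set {set 'rV[F]_l}}) (alpha : {set 'rV[F]_l} -> 'rV[F]_l) :
  (2 <= l)%N ->
  is_arrangement A ->
  (forall H, H \in A ->
     alpha H != 0 /\ (forall v : 'rV[F]_l, (v \in H) = (v *m (alpha H)^T == 0))) ->
  (arr_char_poly A).[((#|F| ^ (l - 2))%N)%:Z] = 0 ->
  exists d : nat,
    (d + \sum_(i < l.-1) #|F| ^ i)%N = #|A| /\
    free_with_exponents A alpha ([seq (#|F| ^ i)%N | i <- iota 0 l.-1] ++ [:: d]).
Proof.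
case: l A alpha => [|[|n]] // A alpha _ arrA alphaP.
rewrite subSS subn1 /= => chi0.
have [d [theta [cardA homt detM]]] := saito_row_exists arrA alphaP chi0.
by exists d; split=> //; apply: saito_free detM.
Qed.
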